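(* Let $F$ be a field and let $X$ be a nonempty subset of $\operatorname{Zar}(F)$ such that $J(X)\neq 0$. If $A(X)$ is a completely integrally closed local ring that is not a valuation ring of $F$, then $\lim(X)$ contains a representation of $A(X)$ (i.e. a subset $Y\subseteq \lim(X)$ with $A(Y)=A(X)$) that is perfect and closed in $\operatorname{Zar}(F)$ with respect to the patch topology.
   Context: A valuation ring of the field $F$ is a subring $V$ of $F$ such that for each $0\ne t\in F$, $t\in V$ or $t^{-1}\in V$ (so $F$ itself is one); $\mathfrak M_V$ denotes its maximal ideal, and $\operatorname{Zar}(F)$ is the set of all valuation rings of $F$. For nonempty $X\subseteq\operatorname{Zar}(F)$ put $A(X)=\bigcap_{V\in X}V$ and $J(X)=\bigcap_{V\in X}\mathfrak M_V$. A representation of a subring $A$ of $F$ is a subset $Y$ of $\operatorname{Zar}(F)$ with $A=A(Y)$. The patch topology on $\operatorname{Zar}(F)$ is the topology having as a basis the sets $\{V: x_1,\dots,x_n\in V,\ y_1\notin V,\dots,y_m\notin V\}$ with $x_i,y_j\in F$, $n,m\ge 0$ (it is compact Hausdorff). $\lim(X)$ is the set of limit points of $X$ in $\operatorname{Zar}(F)$ in the patch topology, i.e. those $U\in\operatorname{Zar}(F)$ such that every patch open neighborhood of $U$ contains a point of $X$ different from $U$. A space is perfect if every point of it is a limit point of it (i.e. it has no isolated points). A local ring is a commutative ring with a unique maximal ideal (not necessarily Noetherian). A domain $A$ with quotient field $Q(A)$ is completely integrally closed if every $t\in Q(A)$ for which there is $0\neq a\in A$ with $at^n\in A$ for all $n>0$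 lies in $A$. *)

(* Defs.v *)
From HB Require Import structures.
From mathcomp Require Import all_boot all_algebra.
From mathcomp Require Import all_classical topology.

Set Implicit Arguments.
Unset Strict Implicit.
Unset Printing Implicit Defensive.

Import GRing.Theory.
Local Open Scope classical_set_scope.
Local Open Scope ring_scope.

Section Subrings.
Variable F : fieldType.
Implicit Types A I M V : set F.

Definition is_subring A := GRing.subring_closed [in A].

Definition is_valuation_ring V :=
  is_subring V /\ forall t : F, t != 0 -> V t \/ V t^-1.

(* Closure under opposites follows from the last clause, as -1 lies in A. *)
Definition is_ideal A I :=
  [/\ I `<=` A, I 0,
      forall x y, I x -> I y -> I (x + y) &
      forall a x, A a -> I x -> I (a * x)].

Definition is_maximal_ideal A M :=
  [/\ is_ideal A M, M <> A &
      forall I, is_ideal A I -> M `<=` I -> I = M \/ I = A].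

Definition is_local_ring A :=
  is_subring A /\ exists! M : set F, is_maximal_ideal A M.

Definition fraction_field A : set F :=
  [set a / b | a in A & b in [set b | A b /\ b != 0]].

Definition completely_integrally_closed A :=
  is_subring A /\
  forall t, fraction_field A t ->
    (exists a, [/\ a != 0, A a &
       forall n : nat, (0 < n)%N -> A (a * t ^+ n)]) ->
    A t.

(* Chosen by the classical choice operator [get]; it is well defined for
   valuation rings by [maximal_idealP] below. *)
Definition maximal_ideal A : set F := get (is_maximal_ideal A).

Lemma subring_props A : is_subring A ->
  [/\ A 1, A 0, forall x, A x -> A (- x),
      forall x y, A x -> A y -> A (x + y) &
      forall x y, A x -> A y -> A (x * y)].
Proof.
case=> /set_mem A1 AB AM.
have AB' x y : A x -> A y -> A (x - y).
  by move=> /mem_set Ax /mem_set Ay; apply/set_mem/AB.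
have A0 : A 0 by rewrite -(subrr 1); apply: AB'.
have AN x : A x -> A (- x) by rewrite -sub0r => Ax; apply: AB'.
split=> // x y.
- by move=> Ax /AN Ay; rewrite -[y]opprK; apply: AB'.
- by move=> /mem_set Ax /mem_set Ay; apply/set_mem/AM.
Qed.

Definition nonunits A : set F := [set x | A x /\ (x = 0 \/ ~ A x^-1)].

Lemma ideal_nonunits A I : is_ideal A I -> I <> A -> I `<=` nonunits A.
Proof.
move=> [IA I0 ID IM] IneA x Ix; split; first exact: IA.
have [->|x0] := eqVneq x 0; first by left.
right=> Axv; apply: IneA; apply/seteqP; split=> // a Aa.
by rewrite -[a]mulr1 -(mulVf x0); apply: (IM) => //; apply: IM.
Qed.

Lemma nonunits_maximal V :
  is_valuation_ring V -> is_maximal_ideal V (nonunits V).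
Proof.
move=> [/subring_props[V1 V0 VN VD VM] Vval].
have nuM a x : V a -> nonunits V x -> nonunits V (a * x).
  move=> Va [Vx nVx]; split; first exact: VM.
  have [->|a0] := eqVneq a 0; first by left; rewrite mul0r.
  case: nVx => [->|nVx]; first by left; rewrite mulr0.
  right; rewrite invfM => /(VM _ _ Va); rewrite mulrA divff // mul1r.
  exact: nVx.
have nuN1 : ~ nonunits V 1.
  by case=> _ [/eqP|]; rewrite ?oner_eq0 // invr1.
have nuD x y : nonunits V x -> nonunits V y -> nonunits V (x + y).
  move=> nx ny.
  have [->|x0] := eqVneq x 0; first by rewrite add0r.
  have [->|y0] := eqVneq y 0; first by rewrite addr0.
  have := Vval (x / y); rewrite mulf_neq0 ?invr_eq0 // => /(_ isT).
  rewrite invf_div => -[Vxy|Vyx].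
  - rewrite (_ : x + y = (x / y + 1) * y); last by rewrite mulrDl divfK ?mul1r.
    by apply: nuM => //; apply: VD.
  - rewrite (_ : x + y = (1 + y / x) * x); last by rewrite mulrDl divfK ?mul1r.
    by apply: nuM => //; apply: VD.
have nu_id : is_ideal V (nonunits V).
  by split=> // [x []//|]; split=> //; left.
split=> //; first by move=> e; apply: nuN1; rewrite e.
move=> I idI nuI; have [->|IneV] := pselect (I = V); first by right.
by left; apply/seteqP; split=> //; apply: ideal_nonunits.
Qed.

Lemma maximal_ideal_unique V M : is_valuation_ring V ->
  is_maximal_ideal V M -> M = nonunits V.
Proof.
move=> /nonunits_maximal[nu_id nuV _] [idM MV Mmax].
by have [] := Mmax _ nu_id (ideal_nonunits idM MV).
Qed.

Lemma maximal_idealE V :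
  is_valuation_ring V -> maximal_ideal V = nonunits V.
Proof.
move=> Vval; apply: get_unique; first exact: nonunits_maximal.
by move=> M; apply: maximal_ideal_unique.
Qed.

Lemma maximal_idealP V M : is_valuation_ring V ->
  is_maximal_ideal V M <-> M = maximal_ideal V.
Proof.
move=> Vval; rewrite maximal_idealE //; split=> [|->].
- exact: maximal_ideal_unique.
- exact: nonunits_maximal.
Qed.

End Subrings.

Record Zar (F : fieldType) := MkZar {
  zar_ring :> set F;
  zar_valuation : is_valuation_ring zar_ring }.

HB.instance Definition _ (F : fieldType) := gen_eqMixin (Zar F).
HB.instance Definition _ (F : fieldType) := gen_choiceMixin (Zar F).

Section Patch.
Variable F : fieldType.

Definition patch_basic (xs ys : seq F) : set (Zar F) :=
  [set V | (forall x, x \in xs -> (V : set F) x) /\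
           (forall y, y \in ys -> ~ (V : set F) y)].

Definition patch_basis : set (set (Zar F)) :=
  [set B | exists xs ys, B = patch_basic xs ys].

Lemma patch_basis_cover : \bigcup_(B in patch_basis) id B = setT.
Proof.
apply/seteqP; split=> // V _; exists (patch_basic [::] [::]) => //.
by exists [::], [::].
Qed.

Lemma patch_basis_join (B C : set (Zar F)) V :
  patch_basis B -> patch_basis C -> id B V -> id C V ->
  exists D, [/\ patch_basis D, id D V & id D `<=` id B `&` id C].
Proof.
move=> [xs [ys ->]] [xs' [ys' ->]] [Vx Vy] [Vx' Vy'].
exists (patch_basic (xs ++ xs') (ys ++ ys')); split.
- by exists (xs ++ xs'), (ys ++ ys').
- by split=> z; rewrite mem_cat => /orP[]; auto.
- by move=> W [Wx Wy]; split; split=> z zs;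
    [apply: Wx|apply: Wy|apply: Wx|apply: Wy]; rewrite mem_cat zs ?orbT.
Qed.

HB.instance Definition _ :=
  isBaseTopological.Build (Zar F) patch_basis_cover patch_basis_join.

Definition zar_inter (X : set (Zar F)) : set F :=
  \bigcap_(V in X) (V : set F).

Definition zar_rad (X : set (Zar F)) : set F :=
  \bigcap_(V in X) maximal_ideal V.

Definition is_representation (A : set F) (Y : set (Zar F)) :=
  A = zar_inter Y.

End Patch.

(* Main.v *)
Require Import Defs.
From mathcomp Require Import all_boot all_algebra finmap.
From mathcomp Require Import all_classical topology.
Local Open Scope classical_set_scope.

Import GRing.Theory.

(** Write A = A(X), and fix a nonzero j in J(X).

    The heart of the proof is that every t outside A is omitted by infinitely
    many members of X ([infinite_omitting]).  Suppose that some member W of X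
    contains t and that only finitely many members omit it, and put
    y = j t^n.  A member containing t has y in its maximal ideal.  For a
    member V omitting t, the value of j t^n strictly decreases with n, so y is
    a unit of V for at most one n; a large n avoids this for the finitely many
    such V.  Then y is a unit of no member of X, hence s = 1 / (1 + y) and
    1 - s lie in every member.  By complete integral closedness some j t^n is
    outside A, so outside a member V0, and this persists for larger n: thus s
    is a nonunit of V0, whereas 1 - s is a nonunit of W.  So neither s nor
    1 - s is a unit of A, which contradicts locality ([local_ring_unit]).  If
    no member of X contains t, the claim is that X is infinite; it follows
    from the previous case applied to some u with neither u nor its inverse in
    A, which exists because A is not a valuation ring of F.

    The patch topology is compact and the sets {V : t in V} are clopen, so the
    infinitely many members omitting t accumulate at a limit point of X that
    omits t.  Hence lim(X) is again a representation of A
    ([limit_point_representation]); it is closed, and j lies in J(lim(X)).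

    By compactness and Zorn's lemma there is a minimal closed representation Y
    of A inside lim(X) ([minimal_closed_representation]).  The previous
    paragraph applies to Y, so lim(Y) is a closed representation contained in
    Y; minimality yields lim(Y) = Y, that is, Y is perfect. *)

(** * Elements of valuation rings *)

Section ValuationRing.
Set Implicit Arguments.
Unset Strict Implicit.
Variable F : fieldType.
Implicit Types (V : Zar F) (x y : F).
Local Open Scope ring_scope.

Lemma zar1 V : zar_ring V 1.
Proof. by case: (subring_props (zar_valuation V).1). Qed.

Lemma zar0 V : zar_ring V 0.
Proof. by case: (subring_props (zar_valuation V).1). Qed.

Lemma zarN V x : zar_ring V x -> zar_ring V (- x).
Proof. by case: (subring_props (zar_valuation V).1) => _ _ + _ _; exact. Qed.

Lemma zarD V x y : zar_ring V x -> zar_ring V y -> zar_ring V (x + y).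
Proof. by case: (subring_props (zar_valuation V).1) => _ _ _ + _; exact. Qed.

Lemma zarM V x y : zar_ring V x -> zar_ring V y -> zar_ring V (x * y).
Proof. by case: (subring_props (zar_valuation V).1) => _ _ _ _; exact. Qed.

Lemma zarX V x n : zar_ring V x -> zar_ring V (x ^+ n).
Proof.
by move=> Vx; elim: n => [|n IHn]; rewrite ?expr0 ?exprS; [exact: zar1|exact: zarM].
Qed.

Lemma zar_invN V x : ~ zar_ring V x -> zar_ring V x^-1.
Proof.
have [-> /(_ (zar0 V))//|x0 nVx] := eqVneq x 0.
by have [] := (zar_valuation V).2 x x0.
Qed.

Lemma zar_radP (X : set (Zar F)) j : j != 0 ->
  zar_rad X j <-> forall V, X V -> zar_ring V j /\ ~ zar_ring V j^-1.
Proof.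
move=> /eqP j0; split=> Xj V XV; have := Xj V XV;
  rewrite maximal_idealE; try exact: zar_valuation.
- by case=> ? [].
- by case=> ? ?; split=> //; right.
Qed.

(** The hypothesis J(X) <> 0 is an inequality of sets; 0 always lies in J(X),
    so it does provide a nonzero element. *)
Lemma zar_rad_neq0 (X : set (Zar F)) : zar_rad X <> [set 0] ->
  exists2 j, j != 0 & zar_rad X j.
Proof.
move=> XJ; apply: contrapT => nj; apply: XJ; apply/seteqP; split=> [j Jj /=|_ ->].
  by apply: contrapT => /eqP j0; apply: nj; exists j.
move=> V XV; rewrite maximal_idealE; last exact: zar_valuation.
by split; [exact: zar0|left].
Qed.

(** In terms of values: when v(t) < 0, the sequence v(x t^n) decreases. *)
Lemma zar_mul_exp_notin V x t m n : ~ zar_ring V t -> (m <= n)%N ->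
  ~ zar_ring V (x * t ^+ m) -> ~ zar_ring V (x * t ^+ n).
Proof.
move=> nVt mn nVm Vn; apply: nVm.
have t0 : t != 0 by apply/eqP => t0; apply: nVt; rewrite t0; exact: zar0.
suff -> : x * t ^+ m = x * t ^+ n * t^-1 ^+ (n - m).
  by apply: zarM => //; apply: zarX; exact: zar_invN.
rewrite -{1}(subnK mn) exprD exprVn [t ^+ _ * _]mulrC mulrA mulfK//.
by rewrite expf_neq0.
Qed.

(** When v(t) < 0, the strictly decreasing sequence v(x t^n) vanishes at most
    once. *)
Lemma zar_mul_exp_unit V x t : ~ zar_ring V t -> x != 0 ->
  \forall n \near \oo, ~ (zar_ring V (x * t ^+ n) /\ zar_ring V (x * t ^+ n)^-1).
Proof.
move=> nVt x0.
have t0 : t != 0 by apply/eqP => t0; apply: nVt; rewrite t0; exact: zar0.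
have [[n0 [_ Vn0]]|nounit] :=
    pselect (exists n, zar_ring V (x * t ^+ n) /\ zar_ring V (x * t ^+ n)^-1).
  exists n0.+1 => // n /= n0n [Vn _]; move: n0n => /zar_mul_exp_notin.
  move=> /(_ V x t nVt); apply=> // Vn1; apply: nVt.
  suff -> : t = x * t ^+ n0.+1 * (x * t ^+ n0)^-1 by exact: zarM.
  by rewrite exprS mulrCA mulfK// mulf_neq0 ?expf_neq0.
by apply: nearW => n Vn; apply: nounit; exists n.
Qed.

(** The complement of 1 / (1 + y) to 1 is obtained by replacing y with its
    inverse; this symmetry exchanges the roles of s and 1 - s below. *)
Lemma subr1_inv1D y : y != 0 -> 1 + y != 0 -> 1 - (1 + y)^-1 = (1 + y^-1)^-1.
Proof.
move=> y0 y1; have -> : 1 + y^-1 = (1 + y) / y by rewrite mulrDl divff// mul1r addrC.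
by rewrite invf_div -{1}(divff y1) -[X in _ - X]mul1r -mulrBl addrC addKr.
Qed.

(** If v(y) <> 0, no cancellation occurs in 1 + y, so v(1 + y) <= 0. *)
Lemma zar_inv1D V y : ~ (zar_ring V y /\ zar_ring V y^-1) ->
  zar_ring V (1 + y)^-1.
Proof.
have nV1D z : ~ zar_ring V z -> zar_ring V (1 + z)^-1.
  move=> nVz; apply: zar_invN => V1z; apply: nVz; rewrite -(addKr 1 z).
  by apply: zarD => //; apply: zarN; exact: zar1.
move=> /not_andP[/nV1D//|nVy].
have [->|y1] := eqVneq (1 + y) 0; first by rewrite invr0; exact: zar0.
have y0 : y != 0 by apply/eqP => y0; apply: nVy; rewrite y0 invr0; exact: zar0.
rewrite -(subKr 1 (1 + y)^-1) subr1_inv1D//.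
by apply: zarD; [exact: zar1|exact/zarN/nV1D].
Qed.

End ValuationRing.

(** * Local rings *)

Section LocalRing.
Set Implicit Arguments.
Unset Strict Implicit.
Variable F : fieldType.
Implicit Types (A I : set F).
Local Open Scope ring_scope.

Lemma sub_maximal_ideal A I : is_subring A -> is_ideal A I -> ~ I 1 ->
  exists2 M, is_maximal_ideal A M & I `<=` M.
Proof.
move=> /subring_props[A1 A0 AN AD AM] idI nI1.
(* The empty set is admitted because it is the union of the empty chain. *)
pose P J := J = set0 \/ [/\ is_ideal A J, ~ J 1 & I `<=` J].
have [G GP Gtot|M [PM Mmax]] := @Zorn_bigcup F P.
  have [[J GJ [x Jx]]|Ge] := pselect (exists2 J, G J & J !=set0); last first.
    left; apply/seteqP; split=> // x [J GJ Jx].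
    by apply: Ge; exists J => //; exists x.
  have GPx K y : G K -> K y -> [/\ is_ideal A K, ~ K 1 & I `<=` K].
    by move=> /GP[->|].
  right; have [[JA J0 JD JM] J1 IJ] := GPx _ _ GJ Jx; split.
  - split.
    + by move=> y [K GK Ky]; have [[KA _ _ _] _ _] := GPx _ _ GK Ky; exact: KA.
    + by exists J.
    + move=> y z [K GK Ky] [L GL Lz].
      have [[_ _ KD _] _ _] := GPx _ _ GK Ky.
      have [[_ _ LD _] _ _] := GPx _ _ GL Lz.
      have [KL|LK] := Gtot _ _ GK GL.
        by exists L => //; apply: LD => //; exact: KL.
      by exists K => //; apply: KD => //; exact: LK.
    + move=> a y Aa [K GK Ky]; exists K => //.
      by have [[_ _ _ +] _ _] := GPx _ _ GK Ky; exact.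
  - by move=> [K GK K1]; have [_ + _] := GPx _ _ GK K1; exact.
  - by move=> y /IJ Jy; exists J.
have I0 : I 0 by case: idI.
have [idM M1 IM] : [/\ is_ideal A M, ~ M 1 & I `<=` M].
  case: PM => // M0; exfalso; apply: (Mmax I); last by right; split.
  by rewrite M0; split=> // /(_ _ I0).
exists M => //; split=> //; first by move=> MA; apply: M1; rewrite MA.
move=> J idJ MJ; have [J1|nJ1] := pselect (J 1).
  right; case: idJ => JA _ _ JM; apply/seteqP; split=> // x Ax.
  by rewrite -(mulr1 x); exact: JM.
left; apply: contrapT => JM; apply: (Mmax J); last first.
  by right; split=> //; exact: subset_trans MJ.
by split=> // JsM; apply: JM; apply/seteqP.
Qed.

(** Nonunits all lie in the maximal ideal, which does not contain
    s + (1 - s) = 1. *)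
Lemma local_ring_unit A s : is_local_ring A -> A s -> A (1 - s) ->
  A s^-1 \/ A (1 - s)^-1.
Proof.
move=> [Asub [M [Mmax Muniq]]] As As1.
have [A1 A0 AN AD AM] := subring_props Asub.
have nonunitM x : A x -> ~ A x^-1 -> M x.
  move=> Ax nAx; have [||N Nmax xN] := @sub_maximal_ideal A [set x * a | a in A] Asub.
  - split.
    + by move=> _ [a Aa <-]; exact: AM.
    + by exists 0; rewrite ?mulr0.
    + by move=> _ _ [a Aa <-] [b Ab <-]; exists (a + b); rewrite ?mulrDr//; exact: AD.
    + by move=> a _ Aa [b Ab <-]; exists (a * b); [exact: AM|rewrite mulrCA].
  - move=> [a Aa xa1]; apply: nAx; have [x0|x0] := eqVneq x 0.
      by rewrite x0 invr0.
    by rewrite -[x^-1]mulr1 -xa1 mulKf.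
  by rewrite (Muniq _ Nmax); apply: xN; exists 1; rewrite ?mulr1.
apply: contrapT => /not_orP[ns ns1]; case: Mmax => -[MA M0 MD MM] MneA _.
apply: MneA; apply/seteqP; split=> // x Ax; rewrite -(mulr1 x); apply: MM => //.
by rewrite -(subrK s 1); apply: MD; exact: nonunitM.
Qed.

End LocalRing.

(** * The patch topology *)

Section Topology.
Set Implicit Arguments.
Unset Strict Implicit.
Variable F : fieldType.
Implicit Types (U V W : Zar F) (X Y : set (Zar F)) (x y t j : F).

Lemma open_patch_basic (xs ys : seq F) : open (patch_basic xs ys).
Proof.
exists [set patch_basic xs ys]; last by rewrite bigcup_set1.
by move=> _ ->; exists xs, ys.
Qed.

Lemma nbhs_patch_basic V (N : set (Zar F)) : nbhs V N ->
  exists xs ys, patch_basic xs ys V /\ patch_basic xs ys `<=` N.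
Proof.
rewrite nbhsE => -[_ [[D sD <-] [B DB BV]] DN].
have [xs [ys eB]] := sD _ DB; exists xs, ys; rewrite -eB; split=> // W BW.
by apply: DN; exists B.
Qed.

Lemma open_zar_in x : open [set V : Zar F | zar_ring V x].
Proof.
rewrite (_ : [set V | _] = patch_basic [:: x] [::]); first exact: open_patch_basic.
apply/seteqP; split=> V /=; last by move=> [+ _]; apply; rewrite mem_head.
by move=> Vx; split=> // y; rewrite inE => /eqP ->.
Qed.

Lemma open_zar_notin x : open [set V : Zar F | ~ zar_ring V x].
Proof.
rewrite (_ : [set V | _] = patch_basic [::] [:: x]); first exact: open_patch_basic.
apply/seteqP; split=> V /=; last by move=> [_ +]; apply; rewrite mem_head.
by move=> Vx; split=> // y; rewrite inE => /eqP ->.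
Qed.

Lemma closed_zar_in x : closed [set V : Zar F | zar_ring V x].
Proof.
rewrite (_ : [set V | _] = ~` [set V | ~ zar_ring V x]).
  exact/open_closedC/open_zar_notin.
by apply/seteqP; split=> V /=; rewrite notK.
Qed.

Lemma closed_zar_notin x : closed [set V : Zar F | ~ zar_ring V x].
Proof. exact/open_closedC/open_zar_in. Qed.

Lemma zar_eq V W : (forall x, zar_ring V x <-> zar_ring W x) -> V = W.
Proof.
case: V W => [V Vv] [W Wv] /= VW.
have {}VW : V = W by apply/seteqP; split=> x /VW.
by case: _ / VW Wv => Wv; congr MkZar; exact: Prop_irrelevance.
Qed.

Lemma zar_accessible : accessible_space (Zar F).
Proof.
move=> V W /eqP VW.
have /existsNP[x VWx] : ~ forall x, zar_ring V x <-> zar_ring W x.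
  by move=> /zar_eq.
have [Vx|nVx] := pselect (zar_ring V x).
  exists [set U : Zar F | zar_ring U x]; split; first exact: open_zar_in.
    exact/mem_set.
  by apply/mem_set => /= Wx; apply: VWx.
exists [set U : Zar F | ~ zar_ring U x]; split; first exact: open_zar_notin.
  exact/mem_set.
by apply/mem_set => /= nWx; apply: VWx; split.
Qed.

Local Open Scope ring_scope.

(** The ring axioms and the valuation property, being disjunctions and
    implications between finitely many memberships, pass to ultralimits. *)
Lemma ultra_valuation_ring (G : set_system (Zar F)) : UltraFilter G ->
  is_valuation_ring [set x | G [set V | zar_ring V x]].
Proof.
move=> GU; split.
  split.
  - by apply/mem_set; apply: filterE => V; exact: zar1.
  - move=> x y /set_mem Gx /set_mem Gy; apply/mem_set.
    apply: filterS2 Gx Gy => V /= Vx Vy; apply: zarD => //; exact: zarN.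
  - move=> x y /set_mem Gx /set_mem Gy; apply/mem_set.
    by apply: filterS2 Gx Gy => V /=; exact: zarM.
move=> t t0 /=; have [|nG] := in_ultra_setVsetC [set V | zar_ring V t] GU.
  by left.
by right; apply: filterS nG => V /=; exact: zar_invN.
Qed.

(** An ultrafilter converges to its ultralimit, since each basic open set is
    given by finitely many memberships and non-memberships, on each of which
    the ultrafilter decides in agreement with the ultralimit. *)
Lemma zar_compact : compact [set: Zar F].
Proof.
rewrite compact_ultra => G GU _.
exists (MkZar (ultra_valuation_ring GU)); split=> // N.
move=> /nbhs_patch_basic[xs [ys [[/= Gxs Gys] sN]]]; apply: (filterS sN).
have Gin (s : seq F) (P : F -> set (Zar F)) :
    (forall x, x \in s -> G (P x)) ->
    G [set V | forall x, x \in s -> P x V].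
  elim: s => [|x s IHs] GP; first by apply: filterE.
  have GPx := GP x (mem_head x s).
  have GPs : G [set V | forall x, x \in s -> P x V].
    by apply: IHs => y ys'; apply: GP; rewrite inE ys' orbT.
  apply: filterS2 GPx GPs => V Px Ps y; rewrite inE => /orP[/eqP ->//|].
  exact: Ps.
apply: filterI; first exact: (Gin xs (fun x => [set V | zar_ring V x])).
apply: (Gin ys (fun x => [set V | ~ zar_ring V x])) => y /Gys.
by have [] := in_ultra_setVsetC [set V | zar_ring V y] GU.
Qed.

(** Cluster points of the filter of cofinite subsets of C are limit points
    of C. *)
Lemma infinite_limit_point (T : topologicalType) (K C : set T) :
  compact K -> C `<=` K -> infinite_set C -> K `&` limit_point C !=set0.
Proof.
move=> Kc CK Cinf.
have CF : ProperFilter (filter_from [set S : set T | finite_set S] (fun S => C `\` S)).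
  apply: filter_from_proper.
    apply: filter_from_filter; first by exists set0; exact: finite_set0.
    move=> S S' Sf S'f; exists (S `|` S'); first by rewrite /= finite_setU.
    by rewrite setDUr.
  by move=> S Sf; apply: infinite_setN0; exact: infinite_setD.
have [|x [Kx clx]] := Kc _ CF.
  by exists set0; [exact: finite_set0|move=> y [/CK]].
exists x; split=> // N Nx.
have /clx/(_ Nx)[y [[Cy yx] Ny]] :
    filter_from [set S : set T | finite_set S] (fun S => C `\` S) (C `\ x).
  by exists [set x] => //; exact: finite_set1.
by exists y; split=> //; apply/eqP.
Qed.

End Topology.

(** * Limit points and representations *)

Section Representation.
Set Implicit Arguments.
Unset Strict Implicit.
Variable F : fieldType.
Implicit Types (V W : Zar F) (X Y : set (Zar F)) (x y t j : F).
Local Open Scope ring_scope.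

(** If only finitely many members of X omitted t, then s = 1 / (1 + j t^n) and
    1 - s would be nonunits of the local ring A(X), for a suitable large n. *)
Lemma infinite_omitting_mem X j W t : j != 0 -> zar_rad X j ->
  completely_integrally_closed (zar_inter X) -> is_local_ring (zar_inter X) ->
  ~ zar_inter X t -> X W -> zar_ring W t ->
  infinite_set [set V | X V /\ ~ zar_ring V t].
Proof.
move=> j0 /(zar_radP _ j0) Jj [Asub Acic] Aloc nAt XW Wt.
set C := [set V | _] => Cfin.
(* Otherwise j t^n would lie in A(X) for all n, and t = (j t) / j would be
   almost integral over A(X). *)
have [n0 [V0 XV0 nV0]] : exists n0, exists2 V, X V & ~ zar_ring V (j * t ^+ n0).
  apply: contrapT => /forallNP jt; apply: nAt.
  have Ajt n : zar_inter X (j * t ^+ n).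
    by move=> V XV; apply: contrapT => nV; apply: (jt n); exists V.
  have Aj : zar_inter X j by move=> V /Jj[].
  apply: Acic; last by exists j.
  exists (j * t ^+ 1) => //; exists j => //.
  by rewrite expr1 mulrC mulKf.
have V0t : ~ zar_ring V0 t.
  by move=> V0t; apply: nV0; apply: zarM; [case: (Jj _ XV0)|exact: zarX].
(* Each of the finitely many members of C excludes at most one n. *)
have [n [nn0 nun]] : exists n, (n0 <= n)%N /\ forall V, C V ->
    ~ (zar_ring V (j * t ^+ n) /\ zar_ring V (j * t ^+ n)^-1).
  apply: (@filter_ex _ \oo); apply: filterI; first exact: nbhs_infty_ge.
  have /filterS : \forall n \near \oo, (\bigcap_(V in [set` fset_set C])
      [set n | ~ (zar_ring V (j * t ^+ n) /\ zar_ring V (j * t ^+ n)^-1)]) n.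
    apply: filter_bigI => V; rewrite in_fset_set// => /set_mem[_ nVt].
    exact: zar_mul_exp_unit.
  by apply=> n nP V CV; apply: nP; rewrite /= in_fset_set//; exact/mem_set.
(* From here on y is a unit of no member of X: it is in the maximal ideal of
   the members containing t, by the factor j, and n was chosen for the others. *)
set y := j * t ^+ n in nun.
have t0 : t != 0 by apply/eqP => t0; apply: V0t; rewrite t0; exact: zar0.
have y0 : y != 0 by rewrite mulf_neq0// expf_neq0.
have nVy V : X V -> zar_ring V t -> ~ zar_ring V y^-1.
  move=> XV Vt Vy; have [_] := Jj _ XV; apply.
  rewrite (_ : j^-1 = y^-1 * t ^+ n); first by apply: zarM => //; exact: zarX.
  by rewrite /y invfM mulrVK// unitfE expf_neq0.
have nuy V : X V -> ~ (zar_ring V y /\ zar_ring V y^-1).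
  move=> XV; have [Vt [_]|nVt] := pselect (zar_ring V t); first exact: nVy.
  exact: nun.
have Ws : ~ zar_ring W (1 + y^-1).
  move=> W1y; apply: (nVy W) => //; rewrite -(addKr 1 y^-1).
  by apply: zarD => //; apply: zarN; exact: zar1.
have y1 : 1 + y != 0.
  rewrite addrC addr_eq0; apply/eqP => y1; apply: (nVy W) => //.
  by rewrite y1 invrN1; apply: zarN; exact: zar1.
have [||/(_ _ XV0)|/(_ _ XW)] := @local_ring_unit _ (zar_inter X) (1 + y)^-1 Aloc.
- by move=> V XV; apply: zar_inv1D; exact: nuy.
- rewrite subr1_inv1D// => V XV; apply: zar_inv1D; rewrite invrK => -[? ?].
  exact: (nuy V).
- rewrite invrK => V0y; apply: (zar_mul_exp_notin V0t nn0 nV0).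
  rewrite -[_ * _](addKr 1); apply: zarD => //; apply: zarN; exact: zar1.
- by rewrite subr1_inv1D// invrK.
Qed.

(** If every member of X omits t, the infinitude of X itself is needed.  An
    element u witnessing that A(X) is not a valuation ring provides it: as the
    inverse of u is not in A(X), some member of X contains u. *)
Lemma infinite_omitting X j t : j != 0 -> zar_rad X j ->
  completely_integrally_closed (zar_inter X) -> is_local_ring (zar_inter X) ->
  ~ is_valuation_ring (zar_inter X) -> ~ zar_inter X t ->
  infinite_set [set V | X V /\ ~ zar_ring V t].
Proof.
move=> j0 Jj Acic Aloc Anval nAt.
have [[W [XW Wt]]|nWt] := pselect (exists W, X W /\ zar_ring W t).
  exact: infinite_omitting_mem j0 Jj Acic Aloc nAt XW Wt.
rewrite (_ : [set V | _] = X); last first.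
  apply/seteqP; split=> V; first by case.
  by move=> XV; split=> // Vt; apply: nWt; exists V.
have [u [u0 nAu nAuV]] : exists u,
    [/\ u != 0, ~ zar_inter X u & ~ zar_inter X u^-1].
  apply: contrapT => nu; apply: Anval; split; first exact: Acic.1.
  move=> u u0; apply: contrapT => /not_orP[nAu nAuV]; apply: nu.
  by exists u.
have [W XW Wu] : exists2 W, X W & zar_ring W u.
  apply: contrapT => nW; apply: nAuV => W XW; apply: zar_invN => Wu.
  by apply: nW; exists W.
have : infinite_set [set V | X V /\ ~ zar_ring V u].
  exact: infinite_omitting_mem j0 Jj Acic Aloc nAu XW Wu.
by apply: sub_infinite_set => V [].
Qed.

(** The members of X omitting t form an infinite subset of the compact set of
    all valuation rings omitting t, so they have a limit point in that set. *)
Lemma limit_point_representation X j : j != 0 -> zar_rad X j ->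
  completely_integrally_closed (zar_inter X) -> is_local_ring (zar_inter X) ->
  ~ is_valuation_ring (zar_inter X) ->
  is_representation (zar_inter X) (limit_point X).
Proof.
move=> j0 Jj Acic Aloc Anval; apply/seteqP; split=> t.
  move=> At V /subset_limit_point XV; apply: (@closed_zar_in F t).
  by apply: closure_subset XV => W XW; exact: At.
move=> limt; apply: contrapT => nAt.
have Xinf : infinite_set [set V | X V /\ ~ zar_ring V t].
  exact: infinite_omitting j0 Jj Acic Aloc Anval nAt.
have nt_compact : compact [set V : Zar F | ~ zar_ring V t].
  exact: subclosed_compact (@closed_zar_notin F t) (@zar_compact F) _.
have [|U [nUt limU]] := infinite_limit_point nt_compact _ Xinf.
  by move=> V [].
apply: nUt; apply: limt => N NU.
by have [V [? [? ?] ?]] := limU _ NU; exists V.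
Qed.

(** For a nonzero j, being in the maximal ideal of V is a clopen condition
    on V; so the hypothesis J <> 0 is inherited by limit points. *)
Lemma zar_rad_limit_point X j : j != 0 -> zar_rad X j ->
  zar_rad (limit_point X) j.
Proof.
move=> j0 /(zar_radP _ j0) Jj; apply/(zar_radP _ j0) => V /subset_limit_point XV.
split.
- by apply: (@closed_zar_in F j); apply: closure_subset XV => W /Jj[].
- by apply: (@closed_zar_notin F j^-1); apply: closure_subset XV => W /Jj[].
Qed.

(** Zorn's lemma is applied to the open sets O for which X \ O is still a
    representation.  For a chain of them with union U and an element t outside
    A, the nonempty compact sets of members of X \ O omitting t are nested, so
    their intersection contains a member of X \ U omitting t. *)
Lemma minimal_closed_representation A X : closed X -> is_representation A X ->
  exists Y, [/\ Y `<=` X, closed Y, is_representation A Y &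
    forall Z, closed Z -> is_representation A Z -> Z `<=` Y -> Z = Y].
Proof.
move=> Xcl XA.
pose P O := open O /\ is_representation A (X `\` O).
have [G GP Gtot|O [[Oop OA] Omax]] := @Zorn_bigcup (Zar F) P.
  split; first by apply: bigcup_open => O /GP[].
  have [->|/set0P[O1 GO1]] := eqVneq G set0; first by rewrite bigcup_set0 setD0.
  apply/seteqP; split=> t; first by rewrite XA => At V [/At].
  move=> At; apply: contrapT => nAt.
  pose B O := [set V | (X `\` O) V /\ ~ zar_ring V t].
  have BF : ProperFilter (filter_from G B).
    apply: filter_from_proper.
      apply: filter_from_filter; first by exists O1.
      move=> O O' GO GO'; have [OO'|O'O] := Gtot _ _ GO GO'.
        exists O' => // V [[XV O'V] Vt]; split; split=> //; split=> //.
        by move=> /OO'.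
      exists O => // V [[XV OV] Vt]; split; split=> //; split=> //.
      by move=> /O'O.
    move=> O /GP[_ OA]; apply: contrapT => B0; apply: nAt; rewrite OA => V OV.
    by apply: contrapT => nVt; apply: B0; exists V.
  have [//|V [_ clV]] := @zar_compact F _ BF; first exact: filterT.
  have BV O : G O -> B O V.
    move=> GO; have BOcl : closed (B O).
      rewrite (_ : B O = X `&` ~` O `&` [set V | ~ zar_ring V t])//.
      apply: closedI; last exact: closed_zar_notin.
      by apply: closedI => //; apply: open_closedC; case: (GP _ GO).
    by apply: BOcl => N NV; apply: clV => //; exists O.
  have [[XV _] nVt] := BV _ GO1; apply: nVt; apply: At; split=> //.
  by move=> [O GO OV]; have [[_ +] _] := BV _ GO; exact.
exists (X `\` O); split=> //.
- by rewrite setDE; apply: closedI => //; exact: open_closedC.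
move=> Z Zcl ZA ZXO; apply: contrapT => ZneXO; apply: (Omax (~` Z)); last first.
  split; first exact: closed_openC.
  by rewrite setDE setCK setIidr// => V /ZXO[].
split; first by move=> V OV /ZXO[_]; exact.
by move=> ZO; apply: ZneXO; apply/seteqP; split=> // V [_ nOV];
  apply: contrapT => /ZO.
Qed.

End Representation.

Theorem theorem3p5 (F : fieldType) (X : set (Zar F)) (X_neq0 : X !=set0)
    (J_neq0 : zar_rad X <> [set 0%R])
    (A_cic : completely_integrally_closed (zar_inter X))
    (A_local : is_local_ring (zar_inter X))
    (A_nval : ~ is_valuation_ring (zar_inter X)) :
  exists Y : set (Zar F),
    [/\ Y `<=` limit_point X, is_representation (zar_inter X) Y &
        perfect_set Y].
Proof.
have [j j0 Jj] := zar_rad_neq0 J_neq0.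
have limcl (Z : set (Zar F)) : closed (limit_point Z).
  exact/limit_point_closed/zar_accessible.
have limA : is_representation (zar_inter X) (limit_point X).
  exact: limit_point_representation Jj _ _ _.
have [Y [YX Ycl YA Ymin]] := minimal_closed_representation (limcl X) limA.
exists Y; split=> //; split=> //; apply: Ymin => //.
- have Yj : zar_rad Y j by move=> V /YX; exact: zar_rad_limit_point.
  by rewrite YA; apply: limit_point_representation Yj _ _ _; rewrite // -YA.
- by apply: subset_trans Ycl; exact: subset_limit_point.
Qed.
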